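(* Let $n\geq 5$ be an odd integer and put $m=\frac{n+1}{2}$. Then the function $\mathbb{F}_{3^n}\to\mathbb{F}_{3^n}$, $x\mapsto x^d$, is APN over $\mathbb{F}_{3^n}$ for $$d=\begin{cases} \dfrac{3^m-1}{2} & \text{if } n\equiv 3 \pmod 4,\\[2mm] \dfrac{3^m-1}{2}+\dfrac{3^n-1}{2} & \text{if } n\equiv 1 \pmod 4.\end{cases}$$
   Context: Let $q=p^n$ with $p$ a prime number and $n$ a positive integer, and let $\mathbb{F}_q$ be the finite field with $q$ elements. For $f:\mathbb{F}_q\to\mathbb{F}_q$ and $a,b\in\mathbb{F}_q$, let $N_f(a,b)$ denote the number of solutions $x\in\mathbb{F}_q$ of the equation $f(x+a)-f(x)=b$. The function $f$ is called APN (almost perfectly nonlinear) if $\Delta_f:=\max\{N_f(a,b) : a,b\in\mathbb{F}_q,\ a\neq 0\}=2$ (the maximum is exactly $2$). *)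

(* Defs.v *)
From mathcomp Require Import all_boot all_algebra.

Set Implicit Arguments.
Unset Strict Implicit.
Unset Printing Implicit Defensive.

Import GRing.Theory.

Section APN.

Variables (F : finFieldType) (f : F -> F).

Definition diff_count (a b : F) : nat :=
  #|[set x : F | f (x + a)%R - f x == b]%R|.

(* The index set is never empty in a field, so the default value 0 of \max
   plays no role. *)
Definition diff_uniformity : nat :=
  \max_(ab : F * F | ab.1 != 0%R) diff_count ab.1 ab.2.

Definition APN : Prop := diff_uniformity = 2.

End APN.

(* Main.v *)
Require Import Defs.
From HB Require Import structures.
From mathcomp Require Import all_boot all_algebra all_field ring zify.

(**
Let Q = 3^m, s(x) = x^Q and N(y) = y s(y) = y^(Q+1), so that s(s(x)) = x^3 on F_q. The power
map f(x) = x^d takes only square values (d is even) and N(f(x)) = ± x, while -1 is not a square.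

At most two solutions. A solution x of f(x + a) - f(x) = b gives squares r = f(x) = z + b and
p = f(x + a) = z - b with e1 N(p) - e2 N(r) = a for signs e1, e2. If e1 = e2 = e, this reads
z s(b) + b s(z) = e a, which determines z up to sign; if e1 = - e2 = e it reads N(z) + N(b) = - e a,
which again determines z up to sign. Replacing z by - z turns the squares p, r into - r, - p, so
each of the cases e1 = e2, (e1, e2) = (1, -1), (e1, e2) = (-1, 1) contributes at most one solution.
The last two cases exclude each other: for the corresponding z, z' one has N(z) + N(z') = N(b),
and as y^2 N(y) = s(N(y)), the square (z^2 - b^2) N(z) N(b) equals s(N(z)) N(b) - s(N(b)) N(z),
which changes sign when z is replaced by z'.

The value two is attained. Otherwise x -> f(x + a) - f(x) is a bijection for all a <> 0 and
sum_(x, y) (x - y)^e (f(x) - f(y))^k = 0 for 0 < e and 0 < k < q - 1. Take (e, k) = (q - Q, 2)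
if n = 1 mod 4 and (e, k) = (q - 3 Q, 2 (1 + 3 + Q)) if n = 3 mod 4. As
(u - v)^(3^s (3^r - 1)) = sum_(t < 3^r) u^(3^s (3^r - 1 - t)) v^(3^s t), the double sum is a sum of
products of two power sums over F_q, and exactly one of these products is nonzero.
*)

Set Implicit Arguments.
Unset Strict Implicit.
Unset Printing Implicit Defensive.

Import GRing.Theory.

(** * Squares in a field where -1 is not a square *)

Section Squares.
Local Open Scope ring_scope.

Definition is_square (F : fieldType) (c : F) : Prop := exists u, c = u ^+ 2.

Lemma is_squareM (F : fieldType) (c e : F) :
  is_square c -> is_square e -> is_square (c * e).
Proof. by move=> [u ->] [v ->]; exists (u * v); rewrite exprMn. Qed.

Lemma is_squareN_eq0 (F : fieldType) (c : F) :
    (forall x : F, x ^+ 2 <> -1) ->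
  is_square c -> is_square (- c) -> c = 0.
Proof.
move=> noI [u ->] [v uv].
have [->|u0] := eqVneq u 0; first by rewrite expr0n.
case: (noI (v / u)); rewrite expr_div_n -uv mulNr divff //.
by rewrite expf_neq0.
Qed.

End Squares.

(** * The equations in [z] attached to a solution, for an abstract [s] with [s (s x) = x ^+ 3] *)

Section SemilinearEquations.
Local Open Scope ring_scope.

Variables (F : fieldType) (s : {rmorphism F -> F}).
Hypothesis three0 : 3%:R = 0 :> F.
Hypothesis ssE : forall x, s (s x) = x ^+ 3.
Hypothesis noI : forall x : F, x ^+ 2 <> -1.

Definition twisted_norm (y : F) : F := y * s y.
Local Notation N := twisted_norm.

Lemma two_neg1 : 2%:R = -1 :> F.
Proof. by apply/eqP; rewrite -subr_eq0 opprK natr1 three0. Qed.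

Lemma twisted_norm_eq0 y : (N y == 0) = (y == 0).
Proof. by rewrite /N mulf_eq0 fmorph_eq0 orbb. Qed.

Lemma twisted_normN y : N (- y) = N y.
Proof. by rewrite /N rmorphN mulrNN. Qed.

Lemma sqrM_twisted_norm y : y ^+ 2 * N y = s (N y).
Proof. by rewrite /N rmorphM ssE; ring. Qed.

(** For [y != 0], [sqrM_twisted_norm] recovers [y ^+ 2] from [N y] as the quotient
    [s (N y) / N y]. *)
Lemma twisted_norm_inj_sqr y z : N y = N z -> y ^+ 2 = z ^+ 2.
Proof.
move=> Nyz; have [z0|z0] := eqVneq z 0.
  by move/eqP: Nyz; rewrite z0 {2}/N mul0r twisted_norm_eq0 => /eqP->.
apply: (@mulIf _ (N z)); first by rewrite twisted_norm_eq0.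
by rewrite -{1}Nyz !sqrM_twisted_norm Nyz.
Qed.

(** Writing [w = v * b] turns the equation into [s v = - v]. Then [v ^+ 3 = s (s v) = v], so [v] is
    0, 1 or -1 and is fixed by [s]; hence [v = - v], and [v = 0]. *)
Lemma twisted_trace_eq0 b w : b != 0 -> w * s b + b * s w = 0 -> w = 0.
Proof.
move=> b0 wb; have [v wE] : exists v, w = v * b by exists (w / b); rewrite divfK.
have sv : s v = - v.
  apply: (@mulIf _ (b * s b)); first by rewrite mulf_neq0 ?fmorph_eq0.
  apply/eqP; rewrite -subr_eq0; apply/eqP; rewrite -wb wE rmorphM.
  by ring.
have v3 : v ^+ 3 = v by rewrite -ssE sv rmorphN sv opprK.
have svv : s v = v -> v = 0.
  rewrite sv => Nv; have : v *+ 2 = 0 by rewrite mulr2n -{1}Nv addNr.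
  by rewrite -mulr_natr two_neg1 mulrN1 => /eqP; rewrite oppr_eq0 => /eqP.
have v3E : v * ((v - 1) * (v + 1)) = v ^+ 3 - v by ring.
have : v * ((v - 1) * (v + 1)) == 0 by rewrite v3E v3 subrr.
rewrite !mulf_eq0 subr_eq0 addr_eq0 => /or3P[] /eqP v1.
- by rewrite wE v1 mul0r.
- by rewrite wE svv ?mul0r // v1 rmorph1.
- by rewrite wE svv ?mul0r // v1 rmorphN1.
Qed.

(* For a solution [x] of [f (x + a) - f x = b], put [r := f x] and [p := f (x + a)]. Since the
   characteristic is 3, [z := r - b = p + b] satisfies [r = z + b] and [p = z - b]. *)
Variable a b : F.
Hypothesis a_neq0 : a != 0.

Definition fiber (e1 e2 z x : F) :=
  [/\ is_square (z - b), is_square (z + b),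
      N (z - b) = e1 * (x + a) & N (z + b) = e2 * x].

Lemma fiber_opp e1 e2 e1' e2' z x x' :
  fiber e1 e2 z x -> fiber e1' e2' (- z) x' -> z = 0 /\ b = 0.
Proof.
move=> [sp sr _ _] [sp' sr' _ _].
have r0 : z + b = 0.
  by apply: is_squareN_eq0 sr _ => //; rewrite opprD.
have p0 : z - b = 0.
  by apply: is_squareN_eq0 sp _ => //; rewrite opprD opprK.
have b0 : b = 0.
  have : b *+ 2 = 0 by rewrite -(subrr 0) -{1}r0 -p0; ring.
  by rewrite -mulr_natr two_neg1 mulrN1 => /eqP; rewrite oppr_eq0 => /eqP.
by split=> //; rewrite -p0 b0 subr0.
Qed.

Lemma fiber_eq e e1 e1' z x x' : e != 0 ->
  fiber e1 e z x -> fiber e1' e z x' -> x = x'.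
Proof. by move=> e0 [_ _ _ xE] [_ _ _ x'E]; apply: (mulfI e0); rewrite -xE. Qed.

Lemma fiber_same e z x :
  fiber e e z x -> z * s b + b * s z = e * a.
Proof.
move=> [_ _ Np Nr].
have -> : e * a = N (z - b) - N (z + b) by rewrite Np Nr; ring.
rewrite /N rmorphB rmorphD; apply/eqP; rewrite -subr_eq0; apply/eqP.
rewrite (_ : _ - _ = 3%:R * (z * s b + b * s z)); last by ring.
by rewrite three0 mul0r.
Qed.

Lemma fiber_mixed e z x :
  fiber e (- e) z x -> N z + N b = - (e * a).
Proof.
move=> [_ _ Np Nr].
have -> : - (e * a) = - (N (z - b) + N (z + b)) by rewrite Np Nr; ring.
rewrite /N rmorphB rmorphD; apply/eqP; rewrite -subr_eq0; apply/eqP.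
rewrite (_ : _ - _ = 3%:R * (z * s z + b * s b)); last by ring.
by rewrite three0 mul0r.
Qed.

Lemma fiber_same_uniq e e' z z' x x' :
    (e == 1) || (e == -1) -> (e' == 1) || (e' == -1) ->
  fiber e e z x -> fiber e' e' z' x' -> x = x'.
Proof.
move=> he he' h h'; have tr := fiber_same h; have tr' := fiber_same h'.
have e0 : e != 0 by case/orP: he => /eqP->; rewrite ?oppr_eq0 oner_eq0.
have b0 : b != 0.
  apply/eqP=> b0; move/eqP: tr.
  by rewrite b0 rmorph0 mulr0 mul0r addr0 eq_sym mulf_eq0 (negPf e0) (negPf a_neq0).
(* The difference of [z'] and [z] if [e' = e], their sum if [e' = - e], solves the homogeneous
   equation of [twisted_trace_eq0]. *)
have [ee|ee] : e' = e \/ e' = - e.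
  case/orP: he => /eqP->; case/orP: he' => /eqP->; rewrite ?opprK; by [left|right].
- have zz : z' = z.
    apply/eqP; rewrite -subr_eq0; apply/eqP; apply: (twisted_trace_eq0 b0).
    rewrite rmorphB -(subrr (e * a)) -{1}ee -tr' -tr.
    by ring.
  by rewrite zz ee in h'; apply: fiber_eq e0 h h'.
have zz : z' = - z.
  apply/eqP; rewrite -addr_eq0; apply/eqP; apply: (twisted_trace_eq0 b0).
  rewrite rmorphD -(subrr (e * a)) -[- _]mulNr -ee -tr' -tr.
  by ring.
rewrite zz in h'; case: (fiber_opp h h') => _ b0'.
by rewrite b0' eqxx in b0.
Qed.

Lemma fiber_mixed_uniq e z z' x x' :
  e != 0 -> fiber e (- e) z x -> fiber e (- e) z' x' -> x = x'.
Proof.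
move=> e0 h h'; have Nz := fiber_mixed h; have := fiber_mixed h'.
rewrite -Nz => /addIr/esym/twisted_norm_inj_sqr/eqP; rewrite eqf_sqr => /orP[] /eqP zz.
  by rewrite -zz in h'; apply: fiber_eq h h'; rewrite oppr_eq0.
rewrite -[z']opprK -zz in h'; case: (fiber_opp h h') => z0 b0.
move/eqP: Nz; rewrite z0 b0 /N !mul0r addr0 eq_sym oppr_eq0 mulf_eq0.
by rewrite (negPf e0) (negPf a_neq0).
Qed.

Hypothesis squareVN : forall x : F, is_square x \/ is_square (- x).

(** One of [z] and [- z] is a square, and the two have the same norm. *)
Lemma twisted_norm_square z : is_square (N z).
Proof.
have Nsq y : is_square y -> is_square (N y).
  by move=> [u ->]; exists (u * s u); rewrite /N rmorphXn exprMn.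
by case: (squareVN z) => /Nsq //; rewrite twisted_normN.
Qed.

Lemma fiber_mixed_excl e z z' x x' :
  e != 0 -> fiber e (- e) z x -> fiber (- e) e z' x' -> False.
Proof.
move=> e0 h h'.
have ea0 : e * a != 0 by rewrite mulf_neq0.
have Nz := fiber_mixed h.
have Nz' : N z' + N b = e * a.
  rewrite -[RHS]opprK -mulNr; apply: (@fiber_mixed _ _ x').
  by rewrite opprK.
have Nzz' : N z + N z' = N b.
  apply/eqP; rewrite -subr_eq0.
  have -> : N z + N z' - N b = (N z + N b) + (N z' + N b) - 3%:R * N b by ring.
  by rewrite Nz Nz' three0 mul0r subr0 addNr.
case: h h' => sp sr _ _ [sp' sr' _ _].
(* [c y] is a square as soon as [y - b] and [y + b] are, while [cE] expresses it antisymmetrically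
   in [N y] and [N b]; with [N b = N z + N z'] this yields [c z' = - c z]. *)
pose c y := (y - b) * (y + b) * (N y * N b).
have cE y : c y = s (N y) * N b - s (N b) * N y.
  by rewrite -!sqrM_twisted_norm /c; ring.
have cN : c z' = - c z.
  by rewrite !cE -{1 3}Nzz' -Nzz' rmorphD; ring.
have csq y : is_square (y - b) -> is_square (y + b) -> is_square (c y).
  move=> sy1 sy2; apply: is_squareM; first exact: is_squareM.
  by apply: is_squareM; apply: twisted_norm_square.
have cz : c z = 0.
  by apply: is_squareN_eq0 (csq _ sp sr) _ => //; rewrite -cN; apply: csq.
have cz' : c z' = 0 by rewrite cN cz oppr0.
have b0 : b != 0.
  apply: contra ea0 => /eqP b0.
  have Nb0 : N b = 0 by rewrite b0 /N mul0r.
  have Nz'E : N z' = - N z by apply/eqP; rewrite -addr_eq0 addrC Nzz' Nb0.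
  have Nz0 : N z = 0.
    by apply: is_squareN_eq0 => //; rewrite -?Nz'E; apply: twisted_norm_square.
  by rewrite -Nz' Nz'E Nz0 Nb0 oppr0 addr0.
have nz y : is_square (y - b) -> is_square (y + b) -> y != 0.
  move=> syb; apply: contraPneq => y0; move: syb; rewrite y0 sub0r add0r => sb' sb.
  by move/eqP: b0; apply; apply: is_squareN_eq0 sb sb'.
have Neq y : y != 0 -> c y = 0 -> N y = N b.
  move=> y0 /eqP; rewrite /c mulf_eq0 (mulf_eq0 (N y)) !twisted_norm_eq0 mulf_eq0.
  rewrite (negPf y0) (negPf b0) !orbF.
  by rewrite subr_eq0 addr_eq0 => /orP[] /eqP-> //; rewrite twisted_normN.
(* [c z = 0] forces [N z = N b], which leaves [N z' = 0] in [Nzz']. *)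
have /eqP := Nzz'; rewrite (Neq z) ?(nz z) // -subr_eq0 addrAC subrr add0r.
by rewrite twisted_norm_eq0 (negPf (nz z' sp' sr')).
Qed.

End SemilinearEquations.

(** * Power sums over a finite field; powers of differences in characteristic 3 *)

Section FiniteField.
Local Open Scope ring_scope.

Variable F : finFieldType.

Lemma expf_card_pred (x : F) : x != 0 -> x ^+ #|F|.-1 = 1.
Proof.
move=> x0; apply: (mulfI x0); rewrite -exprS prednK ?expf_card ?mulr1 //.
exact: ltnW (finNzRing_gt1 F).
Qed.

Lemma expf_add_card_pred (x : F) e k :
  (0 < e)%N -> x ^+ (e + #|F|.-1 * k) = x ^+ e.
Proof.
case: e => // e _; have [->|x0] := eqVneq x 0; first by rewrite addSn !expr0n.
by rewrite exprD exprM expf_card_pred // expr1n mulr1.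
Qed.

(** Shifting the variable of [\sum_x x] by 1 adds [#|F|] to the sum without changing its value. *)
Lemma natr_card_finField : #|F|%:R = 0 :> F.
Proof.
apply: (@addrI _ (\sum_(x : F) x)); rewrite addr0 {2}(reindex_inj (addIr 1)) /=.
by rewrite big_split sumr_const.
Qed.

Lemma sum_expf k :
  \sum_(x : F) x ^+ k = - ((0 < k)%N && (#|F|.-1 %| k)%N)%:R.
Proof.
have q_gt1 := finNzRing_gt1 F.
case: k => [|k] /=.
  (* For exponent 0 the term at [x = 0] is also 1, so the sum is [#|F|], which is 0 in [F]. *)
  under eq_bigr do rewrite expr0.
  by rewrite sumr_const oppr0 natr_card_finField.
case: (boolP (_ %| _)%N) => [/dvdnP[c kE]|ndvd].
  rewrite (bigD1 0) //= expr0n add0r.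
  under eq_bigr => x x0 do rewrite kE mulnC exprM expf_card_pred // expr1n.
  rewrite sumr_const cardC1; apply/eqP; rewrite -addr_eq0 natr1 prednK ?(ltnW q_gt1) //.
  by rewrite natr_card_finField.
have r_gt0 : (0 < k.+1 %% #|F|.-1)%N by rewrite lt0n.
(* Otherwise all [#|F|.-1] nonzero elements would be roots of unity of the smaller order
   [k.+1 %% #|F|.-1]. *)
have /existsP[g /andP[g0 gk]] : [exists g : F, (g != 0) && (g ^+ k.+1 != 1)].
  apply: contraT => /existsPn noG.
  have := @max_unity_roots _ (k.+1 %% #|F|.-1) (enum (predC1 (0 : F))) r_gt0.
  rewrite enum_uniq -cardE cardC1 leqNgt ltn_mod -subn1 subn_gt0 q_gt1.
  apply=> //; apply/allP=> x; rewrite mem_enum => x0.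
  have := noG x; rewrite -[x != 0]/(x \in predC1 0) x0 /= negbK {1}(divn_eq k.+1 #|F|.-1).
  by rewrite exprD mulnC exprM expf_card_pred // expr1n mul1r unity_rootE subn1.
have : (g ^+ k.+1 - 1) * \sum_(x : F) x ^+ k.+1 = 0.
  rewrite mulrBl mul1r {2}(reindex_inj (mulfI g0)) /= mulr_sumr.
  by under [X in _ - X]eq_bigr do rewrite exprMn; rewrite subrr.
by move/eqP; rewrite mulf_eq0 subr_eq0 (negPf gk) oppr0 => /eqP->.
Qed.

(** Put [x = y + a]. For [a != 0] the difference map permutes [F], so the sum over [y] is the power
    sum of exponent [k], which vanishes as [0 < k < #|F|.-1]; the term [a = 0] vanishes because
    [0 < e]. *)
Lemma sum_subXfX0 (f : F -> F) e k :
    (forall a, a != 0 -> injective (fun x => f (x + a) - f x)) ->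
    (0 < e)%N -> (0 < k < #|F|.-1)%N ->
  \sum_x \sum_y (x - y) ^+ e * (f x - f y) ^+ k = 0.
Proof.
move=> inj_f e0 /andP[k0 kq].
rewrite exchange_big /=.
transitivity (\sum_y \sum_a a ^+ e * (f (y + a) - f y) ^+ k).
  apply: eq_bigr => y _; rewrite (reindex_inj (addrI y)) /=.
  by apply: eq_bigr => a _; rewrite [y + a]addrC addrK.
rewrite exchange_big /=; apply: big1 => a _; rewrite -mulr_sumr.
have [->|a0] := eqVneq a 0; first by rewrite expr0n gtn_eqF ?mul0r.
have -> : \sum_y (f (y + a) - f y) ^+ k = \sum_b b ^+ k.
  by rewrite [RHS](reindex_inj (inj_f a a0)).
by rewrite sum_expf k0 gtnNdvd // oppr0 mulr0.
Qed.

Hypothesis charF : 3 \in [pchar F].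

Lemma expr3B (u v : F) r : (u - v) ^+ (3 ^ r) = u ^+ (3 ^ r) - v ^+ (3 ^ r).
Proof.
elim: r => [|r IH]; first by rewrite !expr1.
rewrite expnSr !exprM IH.
by rewrite -!(pFrobenius_autE charF) rmorphB.
Qed.

Lemma exprB_predX3 (u v : F) s r :
  (u - v) ^+ (3 ^ s * (3 ^ r).-1)
    = \sum_(t < 3 ^ r) u ^+ (3 ^ s * ((3 ^ r).-1 - t)) * v ^+ (3 ^ s * t).
Proof.
rewrite exprM expr3B; under eq_bigr do rewrite !exprM.
move: (u ^+ _) (v ^+ _) => {}u {}v.
(* The identity is [expr3B] divided by [u - v]. For [u = v] the right side has [3 ^ r] equal terms,
   so it is 0 unless [r = 0]. *)
have [->|uv] := eqVneq u v.
  rewrite (eq_bigr (fun=> v ^+ (3 ^ r).-1)) => [|t _]; last first.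
    by rewrite -exprD subnK // -ltnS prednK ?expn_gt0.
  rewrite sumr_const card_ord subrr expr0n.
  case: r => [|r]; first by rewrite expr0.
  rewrite -[RHS]mulr_natr natrX (pcharf0 charF) expr0n mulr0.
  by rewrite -subn1 subn_eq0 leqNgt (@ltn_exp2l 3 0).
apply: (@mulfI _ (u - v)); first by rewrite subr_eq0.
by rewrite -exprS prednK ?expn_gt0 // expr3B subrXX.
Qed.

Lemma injective_diff_contra (I : finType) (i0 : I) (E1 E2 : I -> nat) d e k :
    (forall a, a != 0 -> injective (fun x : F => (x + a) ^+ d - x ^+ d)) ->
    (0 < e)%N -> (0 < k < #|F|.-1)%N ->
    (forall x y : F, (x - y) ^+ e * (x ^+ d - y ^+ d) ^+ k
                     = \sum_i x ^+ E1 i * y ^+ E2 i) ->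
    (forall i, [&& 0 < E1 i, #|F|.-1 %| E1 i, 0 < E2 i & #|F|.-1 %| E2 i]%N
               = (i == i0)) ->
  False.
Proof.
move=> inj_d e0 kq expE uniq_i.
have /eqP := sum_subXfX0 inj_d e0 kq.
under eq_bigr do under eq_bigr do rewrite expE.
under eq_bigr do rewrite exchange_big /=.
rewrite exchange_big /= (eq_bigr (fun i => (i == i0)%:R)); last first.
  move=> i _; under eq_bigr do rewrite -mulr_sumr.
  by rewrite -mulr_suml !sum_expf mulrNN -natrM mulnb -uniq_i -!andbA.
by rewrite (bigD1 i0) //= eqxx big1 ?addr0 ?oner_eq0 // => i /negPf->.
Qed.

End FiniteField.

(** * Arithmetic of the exponents, with [R = 3 ^ r] and q equal to [3 * R ^ 2] or [27 * R ^ 2] *)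

Lemma exponent_mod1 (R d t a : nat) :
    1 < R -> 2 * d + 2 = 3 * R ^ 2 + 3 * R -> t < R -> a < 3 ->
  [&& 0 < 3 * R * (R - 1 - t) + d * (2 - a),
      3 * R ^ 2 - 1 %| 3 * R * (R - 1 - t) + d * (2 - a),
      0 < 3 * R * t + d * a & 3 * R ^ 2 - 1 %| 3 * R * t + d * a]
    = (2 * t + 1 == R) && (a == 1).
Proof.
rewrite -mulnn => R1 dE tR a3.
have [u uE] : exists u, R = t + u + 1 by exists (R - t - 1); lia.
have -> : R - 1 - t = u by lia.
apply/idP/idP.
  (* The two exponents add up to 2 (q - 1), so as positive multiples of q - 1 they both equal q -
     1. *)
  case/and4P=> E1 /(dvdn_leq E1) leE1 E2 /(dvdn_leq E2) leE2.
  have [a0|[a1|a2]] : a = 0 \/ a = 1 \/ a = 2 by lia.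
  - by subst a; nia.
  - subst a; rewrite andbT.
    have : 3 * R * t + d = 3 * R * R - 1 by nia.
    by move=> E; apply/eqP; nia.
  - by subst a; nia.
case/andP=> /eqP tE /eqP aE; subst a.
have -> : u = t by lia.
have -> : 3 * R * t + d * (2 - 1) = 3 * (R * R) - 1 by nia.
by rewrite !dvdnn; nia.
Qed.

Lemma exponent_mod3 (R d t a b c : nat) :
    8 < R -> 2 * d + 1 = 9 * R -> t < R -> a < 3 -> b < 3 -> c < 3 ->
  let E1 := 27 * R * (R - 1 - t) + d * (1 * (2 - a) + 3 * (2 - b) + 9 * R * (2 - c)) in
  let E2 := 27 * R * t + d * (1 * a + 3 * b + 9 * R * c) in
  [&& 0 < E1, 27 * R ^ 2 - 1 %| E1, 0 < E2 & 27 * R ^ 2 - 1 %| E2]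
    = [&& 2 * t + 1 == R, a == 1, b == 1 & c == 1].
Proof.
rewrite -mulnn /= => R8 dE tR a3 b3 c3.
have [u uE] : exists u, R = t + u + 1 by exists (R - t - 1); lia.
have -> : R - 1 - t = u by lia.
set D := 27 * (R * R) - 1.
(* Modulo [D], [h] replaces [d * (9 * R)]; the reduced exponents then add up to [2 * D]. *)
have [h hE] : exists h, d * (9 * R) = D + h.
  by exists (d * (9 * R) - D); rewrite /D; nia.
have [a' aE] : exists a', a + a' = 2 by exists (2 - a); lia.
have [b' bE] : exists b', b + b' = 2 by exists (2 - b); lia.
have [c' cE] : exists c', c + c' = 2 by exists (2 - c); lia.
have [-> -> ->] : [/\ 2 - a = a', 2 - b = b' & 2 - c = c'] by split; lia.
have h2 : 2 * h + 9 * R = 27 * (R * R) + 2 by rewrite /D in hE; nia.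
have h_gt0 : 0 < h by nia.
have splitE v x y z : 27 * R * v + d * (1 * x + 3 * y + 9 * R * z)
    = 27 * R * v + d * (x + 3 * y) + h * z + z * D.
  by rewrite mul1n mulnDr [d * (9 * R * z)]mulnA hE; lia.
rewrite !splitE.
have red v x y z : 0 < 27 * R * v + d * (x + 3 * y) + h * z + z * D ->
    D %| 27 * R * v + d * (x + 3 * y) + h * z + z * D ->
    D <= 27 * R * v + d * (x + 3 * y) + h * z.
  move=> E0; rewrite dvdn_addl ?dvdn_mull // => /dvdn_leq; apply.
  move: E0; case: (z) => [|z']; first by rewrite mul0n addn0.
  by move=> _; rewrite addn_gt0 (muln_gt0 h) h_gt0 orbT.
apply/idP/idP.
  case/and4P=> E1 /(red _ _ _ _ E1) leE1 E2 /(red _ _ _ _ E2) leE2.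
  have {leE1 leE2 E1 E2} E : 27 * R * t + d * (a + 3 * b) + h * c = D.
    have dS : d * (a + 3 * b) + d * (a' + 3 * b') = 8 * d.
      by rewrite -mulnDr mulnC; congr (_ * _); lia.
    have hS : h * c + h * c' = 2 * h by rewrite -mulnDr cE mulnC.
    have tS : 27 * R * t + 27 * R * u + 27 * R = 27 * (R * R) by rewrite uE; ring.
    by rewrite /D in leE1 leE2 *; lia.
  have {}E : 54 * (R * t) + 27 * (R * R) * c + 9 * R * (a + 3 * b) + 2 * c + 2
           = 54 * (R * R) + (a + 3 * b) + 9 * R * c.
    by rewrite /D in E; nia.
  pose A := 54 * t + 27 * (R * c) + 9 * (a + 3 * b); pose B := 54 * R + 9 * c.
  have {}E : R * A + (2 * c + 2) = R * B + (a + 3 * b) by rewrite /A /B; nia.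
  (* Both [2 * c + 2] and [a + 3 * b] are below [R], so they are the remainders of one number modulo
     [R]. *)
  have AB : A = B.
    by case: (ltngtP A B) => // lt; have := leq_mul (leqnn R) lt; rewrite mulnS; lia.
  have ab : a + 3 * b = 2 * c + 2 by rewrite AB in E; lia.
  rewrite /A /B ab in AB.
  have c1 : c = 1 by have [c0|[//|c2]] : c = 0 \/ c = 1 \/ c = 2 by [lia]; subst c; lia.
  by subst c; lia.
case/and4P=> /eqP tE /eqP a1 /eqP b1 /eqP c1; subst a b c.
have [-> -> ->] : [/\ a' = 1, b' = 1 & c' = 1] by split; lia.
have -> : u = t by lia.
have -> : 27 * R * t + d * (1 + 3 * 1) + h * 1 = D by rewrite /D; nia.
by rewrite -mulSn dvdn_mull //= andbT andbb muln_gt0 /D; nia.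
Qed.


(** * Some difference map is not injective *)

Section NotPlanar.
Local Open Scope ring_scope.

Variables (F : finFieldType) (d r : nat).

Lemma not_planar_mod1 :
    #|F| = (3 ^ (2 * r + 1))%N -> (0 < r)%N ->
    (2 * d + 2 = 3 * (3 ^ r) ^ 2 + 3 * 3 ^ r)%N ->
  (forall a : F, a != 0 -> injective (fun x => (x + a) ^+ d - x ^+ d)) -> False.
Proof.
move=> cardF r_gt0 dE inj_d.
have charF : 3 \in [pchar F] by apply: card_finPcharP cardF _.
set R := (3 ^ r)%N in dE.
have qE : #|F| = (3 * R ^ 2)%N by rewrite cardF expnD expn1 mulnC mul2n -addnn expnD mulnn.
have R3 : (2 < R)%N by rewrite /R -[3%N]expn1 leq_exp2l.
have oddR : odd R by rewrite oddX orbT.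
have tR : (R./2 < R)%N by lia.
(* An index collects the summation variables of [exprB_predX3] for the two factors; the surviving
   one is the middle index of each sum. *)
pose I := ('I_(3 ^ r) * 'I_(3 ^ 1))%type.
pose E1 (i : I) := (3 ^ r.+1 * ((3 ^ r).-1 - i.1) + d * (3 ^ 0 * ((3 ^ 1).-1 - i.2)))%N.
pose E2 (i : I) := (3 ^ r.+1 * i.1 + d * (3 ^ 0 * i.2))%N.
apply: (@injective_diff_contra F I (Ordinal tR, Ordinal (isT : (1 < 3 ^ 1)%N)) E1 E2
  d (3 ^ r.+1 * (3 ^ r).-1) (3 ^ 0 * (3 ^ 1).-1) inj_d).
- by rewrite muln_gt0 expn_gt0 /= -/R; lia.
- by rewrite qE -mulnn; nia.
- move=> x y; rewrite !exprB_predX3 // big_distrlr pair_big /=.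
  by apply: eq_bigr => i _; rewrite -!exprM mulrACA -!exprD.
- move=> [t a] /=; rewrite /E1 /E2 /= qE expnS -/R !mul1n -!subn1 exponent_mod1 //; try lia.
  by rewrite xpair_eqE -!val_eqE /=; congr (_ && _); lia.
Qed.

Lemma not_planar_mod3 :
    #|F| = (3 ^ (2 * r + 3))%N -> (1 < r)%N -> (2 * d + 1 = 9 * 3 ^ r)%N ->
  (forall a : F, a != 0 -> injective (fun x => (x + a) ^+ d - x ^+ d)) -> False.
Proof.
move=> cardF r_gt1 dE inj_d.
have charF : 3 \in [pchar F] by apply: card_finPcharP cardF _.
set R := (3 ^ r)%N in dE.
have qE : #|F| = (27 * R ^ 2)%N by rewrite cardF expnD mulnC mul2n -addnn expnD mulnn.
have R9 : (8 < R)%N by rewrite /R -[9%N]/(3 ^ 2)%N leq_exp2l.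
have oddR : odd R by rewrite oddX orbT.
have tR : (R./2 < R)%N by lia.
(* The exponent [2 * (1 + 3 + 9 * R)] splits into three pieces [3 ^ s * (3 ^ 1).-1], with s = 0, 1,
   [r + 2], each contributing one index below 3. *)
pose I := ('I_(3 ^ r) * ('I_(3 ^ 1) * ('I_(3 ^ 1) * 'I_(3 ^ 1))))%type.
pose E1 (i : I) := (3 ^ (r + 3) * ((3 ^ r).-1 - i.1)
  + d * (3 ^ 0 * ((3 ^ 1).-1 - i.2.1) + 3 ^ 1 * ((3 ^ 1).-1 - i.2.2.1)
         + 3 ^ (r + 2) * ((3 ^ 1).-1 - i.2.2.2)))%N.
pose E2 (i : I) := (3 ^ (r + 3) * i.1
  + d * (3 ^ 0 * i.2.1 + 3 ^ 1 * i.2.2.1 + 3 ^ (r + 2) * i.2.2.2))%N.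
have o1 : (1 < 3 ^ 1)%N by [].
apply: (@injective_diff_contra F I
  (Ordinal tR, (Ordinal o1, (Ordinal o1, Ordinal o1))) E1 E2 d (3 ^ (r + 3) * (3 ^ r).-1)
  (3 ^ 0 * (3 ^ 1).-1 + 3 ^ 1 * (3 ^ 1).-1 + 3 ^ (r + 2) * (3 ^ 1).-1) inj_d).
- by rewrite muln_gt0 expn_gt0 /= -/R; lia.
- by rewrite qE expnD -/R -mulnn; nia.
- move=> x y; rewrite !exprD !exprB_predX3 // -mulrA.
  do 3!rewrite big_distrlr pair_big /=.
  apply: eq_bigr => i _; rewrite -!exprM /E1 /E2 !mulnDr !exprD.
  by ring.
- move=> [t [a [b c]]] /=; rewrite /E1 /E2 /= qE !expnD -/R -!subn1.
  have -> : (R * 3 ^ 3 = 27 * R)%N by lia.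
  have -> : (R * 3 ^ 2 = 9 * R)%N by lia.
  rewrite exponent_mod3 //.
  by rewrite !xpair_eqE -!val_eqE /=; congr (_ && _); lia.
Qed.

End NotPlanar.

(** * Iterated Frobenius as a ring morphism *)

Section Frobenius.
Local Open Scope ring_scope.

(** The proof of characteristic 3 is an argument so that the morphism instances can be attached to
    the map. *)
Definition frob3 (F : finFieldType) of 3 \in [pchar F] := fun (k : nat) (x : F) => x ^+ (3 ^ k).

Variables (F : finFieldType) (charF : 3 \in [pchar F]) (k : nat).

Fact frob3_is_zmod_morphism : zmod_morphism (frob3 charF k).
Proof. by move=> x y; apply: expr3B. Qed.

Fact frob3_is_monoid_morphism : monoid_morphism (frob3 charF k).
Proof. by split=> [|x y]; rewrite /frob3 ?expr1n // exprMn. Qed.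

HB.instance Definition _ :=
  GRing.isZmodMorphism.Build F F (frob3 charF k) frob3_is_zmod_morphism.
HB.instance Definition _ :=
  GRing.isMonoidMorphism.Build F F (frob3 charF k) frob3_is_monoid_morphism.

End Frobenius.

(** * Squares and signs when q is 3 modulo 4 *)

Section OddHalf.
Local Open Scope ring_scope.

Variables (F : finFieldType) (h : nat).
Hypothesis cardF : #|F| = (2 * h + 1)%N.
Hypothesis odd_h : odd h.

Lemma expf_half (x : F) : x * x ^+ h = x \/ x * x ^+ h = - x.
Proof.
have [->|x0] := eqVneq x 0; first by left; rewrite mul0r.
have : (x ^+ h) ^+ 2 == 1.
  by rewrite -exprM mulnC -(addnK 1 (2 * h)%N) -cardF subn1 expf_card_pred.
rewrite -subr_eq0 subr_sqr_1 mulf_eq0 subr_eq0 addr_eq0.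
by case/orP=> /eqP->; rewrite ?mulr1 ?mulrN1; [left|right].
Qed.

Lemma expf_half_mod (x : F) k e :
  e = (#|F| + h + #|F|.-1 * k)%N -> x ^+ e = x \/ x ^+ e = - x.
Proof.
move=> ->; rewrite expf_add_card_pred ?cardF ?addn1 //.
by rewrite -[(2 * h).+1]addn1 -cardF exprD expf_card; apply: expf_half.
Qed.

(** As [h] is odd, [x * x ^+ h] is a square, and it equals [x] or [- x]. *)
Lemma finField_squareVN (x : F) : is_square x \/ is_square (- x).
Proof.
have xh : (x ^+ (h.+1)./2) ^+ 2 = x * x ^+ h.
  by rewrite -exprM -exprS; congr (x ^+ _); lia.
case: (expf_half x) => <-; rewrite -xh; [left|right]; by eexists.
Qed.

Lemma finField_sqr_neqN1 : 2%:R != 0 :> F -> forall x : F, x ^+ 2 <> -1.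
Proof.
move=> two0 x x2; case/negP: two0.
have x0 : x != 0.
  by apply: contra_eq_neq x2 => ->; rewrite expr0n eq_sym oppr_eq0 oner_eq0.
have : x ^+ #|F|.-1 = 1 by apply: expf_card_pred.
rewrite cardF addn1 /= exprM x2 -signr_odd odd_h expr1 => /eqP.
by rewrite eq_sym -addr_eq0.
Qed.

End OddHalf.

(** * At most two solutions *)

Section APNBound.
Local Open Scope ring_scope.

Variables (F : finFieldType) (n d : nat).
Hypothesis cardF : #|F| = (3 ^ n)%N.
Hypothesis odd_n : odd n.
Hypothesis even_d : ~~ odd d.
Local Notation m := ((n + 1) %/ 2)%N.
Hypothesis norm_d : forall x : F,
  x ^+ (d * (3 ^ m).+1) = x \/ x ^+ (d * (3 ^ m).+1) = - x.

Lemma diff_count_le2 a b : a != 0 -> (diff_count (fun x : F => x ^+ d) a b <= 2)%N.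
Proof.
move=> a0; have charF : 3 \in [pchar F] by apply: card_finPcharP cardF _.
have three0 : 3%:R = 0 :> F by apply: pcharf0.
have two0 : 2%:R != 0 :> F by rewrite (two_neg1 three0) oppr_eq0 oner_eq0.
pose h := (3 ^ n)./2.
have odd_3n : odd (3 ^ n) by rewrite oddX orbT.
have [odd_h cardE] : odd h /\ #|F| = (2 * h + 1)%N.
  have nE : n = (2 * n./2 + 1)%N by lia.
  have : (3 ^ n = 3 * 9 ^ n./2)%N by rewrite {1}nE expnD expn1 expnM mulnC.
  have : (9 ^ n./2 %% 4 = 1)%N by rewrite -modnXm exp1n.
  by rewrite cardF /h; lia.
pose s : {rmorphism F -> F} := frob3 charF m.
(* Since [m + m = n + 1], applying [s] twice raises to the power 3q, and [x ^+ q = x]. *)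
have ssE x : s (s x) = x ^+ 3.
  rewrite /= /frob3 -exprM -expnD.
  have -> : (m + m = n + 1)%N by lia.
  by rewrite expnD exprM -cardF expf_card.
have noI := finField_sqr_neqN1 cardE odd_h two0.
have sqVN := finField_squareVN cardE odd_h.
have sq_f (x : F) : is_square (x ^+ d).
  by exists (x ^+ d./2); rewrite -exprM; congr (x ^+ _); lia.
have norm_f (x : F) : exists e, [/\ (e == 1) || (e == -1)
    & twisted_norm s (x ^+ d) = e * x].
  have NE : twisted_norm s (x ^+ d) = x ^+ (d * (3 ^ m).+1).
    by rewrite /twisted_norm /= /frob3 -exprM -exprD mulnS.
  rewrite NE; case: (norm_d x) => ->; [exists 1|exists (-1)];
    by rewrite ?mul1r ?mulN1r eqxx ?orbT.
have fib (x : F) : (x + a) ^+ d - x ^+ d = b ->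
    exists e1 e2 z, [/\ (e1 == 1) || (e1 == -1), (e2 == 1) || (e2 == -1)
                      & fiber s a b e1 e2 z x].
  move=> bE; have [e1 [he1 N1]] := norm_f (x + a); have [e2 [he2 N2]] := norm_f x.
  have zp : x ^+ d - b - b = (x + a) ^+ d.
    have -> : (x + a) ^+ d = x ^+ d + b by rewrite -bE [RHS]addrC subrK.
    apply/eqP; rewrite -subr_eq0; apply/eqP.
    rewrite (_ : _ - _ = - (3%:R * b)); last by ring.
    by rewrite three0 mul0r oppr0.
  exists e1, e2, (x ^+ d - b); split=> //.
  by split; rewrite ?zp ?subrK.
rewrite leqNgt; apply/negP => /card_gt2P[x [y [z [[xD yD zD] [xy yz zx]]]]].
rewrite !inE in xD yD zD.
pose same x := exists e t, ((e == 1) || (e == -1)) /\ fiber s a b e e t x.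
pose mixed e x := exists t, fiber s a b e (- e) t x.
have cls w : (w + a) ^+ d - w ^+ d == b -> [\/ same w, mixed 1 w | mixed (-1) w].
  move=> /eqP /fib[e1 [e2 [t [/orP[]/eqP-> /orP[]/eqP-> ft]]]].
  - by constructor 1; exists 1, t; rewrite eqxx.
  - by constructor 2; exists t.
  - by constructor 3; exists t; rewrite opprK.
  - by constructor 1; exists (-1), t; rewrite eqxx orbT.
have same_uniq u v : same u -> same v -> u = v.
  by case=> e [t [he ft]] [e' [t' [he' ft']]]; apply: fiber_same_uniq ft ft'.
have mixed_uniq e u v : e != 0 -> mixed e u -> mixed e v -> u = v.
  by move=> e0 [t ft] [t' ft']; apply: fiber_mixed_uniq e0 ft ft'.
have mixed_excl u v : mixed 1 u -> mixed (-1) v -> False.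
  by case=> t ft [t' ft']; rewrite opprK in ft'; apply: fiber_mixed_excl ft ft'; rewrite ?oner_eq0.
have n1 : 1 != 0 :> F := oner_neq0 F.
have nN1 : -1 != 0 :> F by rewrite oppr_eq0.
have eq_contra u v : u != v -> u = v -> False by move=> /eqP.
have := cls x xD; have := cls y yD; have := cls z zD.
(* Either two of the three points share a class, against their distinctness, or both mixed classes
   are inhabited, against [mixed_excl]. *)
case=> hz; case=> hy; case=> hx.
all: try by apply: (eq_contra _ _ xy); eauto.
all: try by apply: (eq_contra _ _ yz); eauto.
all: try by apply: (eq_contra _ _ zx); eauto.
all: by eauto.
Qed.

End APNBound.

(** * Assembly, and the numerical conditions on [d] *)

Lemma APN_of_bound (F : finFieldType) (f : F -> F) :
    (forall a b, a != 0%R -> diff_count f a b <= 2) ->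
    ~ (forall a, a != 0%R -> injective (fun x => f (x + a) - f x)%R) -> APN f.
Proof.
move=> le2 not_inj; apply/eqP; rewrite eqn_leq; apply/andP; split.
  by apply/bigmax_leqP => -[a b] /= a0; apply: le2.
rewrite leqNgt; apply/negP => lt2; apply: not_inj => a a0 x y xy.
have cle : diff_count f a (f (x + a) - f x)%R <= 1.
  rewrite -ltnS; apply: leq_ltn_trans lt2.
  exact: (@leq_bigmax_cond _ _ (fun ab : F * F => diff_count f ab.1 ab.2) (a, _) a0).
move/card_le1_eqP: cle => cle; apply: (cle y x); rewrite inE ?xy //.
Qed.

(** With [3 * R] equal to [3 ^ m], this brings [d * (3 ^ m).+1] into the form required by
    [expf_half_mod], so that the norm of [x ^+ d] is [x] or [- x]. *)
Lemma norm_exponent_mod1 R d : odd R -> 2 * d + 2 = 3 * R ^ 2 + 3 * R ->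
  d * (3 * R).+1 = 3 * R ^ 2 + (3 * R ^ 2)./2 + (3 * R ^ 2).-1 * (3 * R + 1)./2.
Proof.
move=> Rodd; have [j ->] : exists j, R = 2 * j + 1 by exists R./2; lia.
have -> : (2 * j + 1) ^ 2 = 4 * (j * j) + 4 * j + 1 by rewrite -mulnn; lia.
move=> dE; have -> : d = 6 * (j * j) + 9 * j + 2 by lia.
have -> : (3 * (4 * (j * j) + 4 * j + 1))./2 = 6 * (j * j) + 6 * j + 1 by lia.
have -> : (3 * (4 * (j * j) + 4 * j + 1)).-1 = 12 * (j * j) + 12 * j + 2 by lia.
have -> : (3 * (2 * j + 1) + 1)./2 = 3 * j + 2 by lia.
by lia.
Qed.

Lemma norm_exponent_mod3 R d : odd R -> 2 * d + 1 = 9 * R ->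
  d * (9 * R).+1 = 27 * R ^ 2 + (27 * R ^ 2)./2.
Proof.
move=> Rodd; have [j ->] : exists j, R = 2 * j + 1 by exists R./2; lia.
have -> : (2 * j + 1) ^ 2 = 4 * (j * j) + 4 * j + 1 by rewrite -mulnn; lia.
move=> dE; have -> : d = 9 * j + 4 by lia.
have -> : (27 * (4 * (j * j) + 4 * j + 1))./2 = 54 * (j * j) + 54 * j + 13 by lia.
by lia.
Qed.

Lemma pow3_even_mod8 r : ~~ odd r -> 3 ^ r %% 8 = 1.
Proof.
move=> even_r; have -> : r = 2 * r./2 by lia.
by rewrite expnM -modnXm exp1n.
Qed.

Theorem mainTheorem1 (F : finFieldType) (n m d : nat)
    (cardF : #|F| = 3 ^ n)
    (n_ge5 : 5 <= n)
    (n_odd : odd n)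
    (def_m : m = (n + 1) %/ 2)
    (def_d3 : n = 3 %[mod 4] -> d = (3 ^ m - 1) %/ 2)
    (def_d1 : n = 1 %[mod 4] -> d = (3 ^ m - 1) %/ 2 + (3 ^ n - 1) %/ 2) :
  APN (fun x : F => (x ^+ d)%R).
Proof.
have n4 : n %% 4 = 1 \/ n %% 4 = 3 by lia.
(* This [r] is even and [n] is [2 * r + 1] or [2 * r + 3]; the resulting [3 ^ r %% 8 = 1] makes [d]
   even. *)
pose r := if n %% 4 == 1 then n./2 else n./2.-1.
have r8 : 3 ^ r %% 8 = 1 by apply: pow3_even_mod8; rewrite /r; case: ifP; lia.
have [n1|n3] := n4.
  have nE : n = 2 * r + 1 by rewrite /r n1 /=; lia.
  have mE : 3 ^ m = 3 * 3 ^ r by rewrite -expnS; congr (_ ^ _); lia.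
  have qE : 3 ^ n = 3 * (3 ^ r) ^ 2 by rewrite -expnM -expnS; congr (_ ^ _); lia.
  have := def_d1 n1; rewrite mE qE; clear def_d3 def_d1 n4.
  set R := 3 ^ r in r8 mE qE * => dE; have Rodd : odd R by rewrite oddX orbT.
  have R2 : R ^ 2 %% 8 = 1 by rewrite -modnXm r8.
  have d2 : 2 * d + 2 = 3 * R ^ 2 + 3 * R by lia.
  apply: APN_of_bound => [a b a0|inj_d].
    apply: (diff_count_le2 cardF) => //; first by lia.
    have hE : #|F| = 2 * (3 * R ^ 2)./2 + 1 by rewrite cardF qE; lia.
    move=> x; apply: (expf_half_mod hE x (k := (3 * R + 1)./2)).
    by rewrite -def_m mE cardF qE; apply: norm_exponent_mod1.
  apply: (not_planar_mod1 (r := r) _ _ d2 inj_d); first by rewrite cardF -nE.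
  by lia.
have nE : n = 2 * r + 3 by rewrite /r n3 /=; lia.
have mE : 3 ^ m = 9 * 3 ^ r by rewrite -(expnD 3 2); congr (_ ^ _); lia.
have qE : 3 ^ n = 27 * (3 ^ r) ^ 2 by rewrite -expnM -(expnD 3 3); congr (_ ^ _); lia.
have := def_d3 n3; rewrite mE; clear def_d3 def_d1 n4.
set R := 3 ^ r in r8 mE qE * => dE; have Rodd : odd R by rewrite oddX orbT.
have R2 : R ^ 2 %% 8 = 1 by rewrite -modnXm r8.
have d2 : 2 * d + 1 = 9 * R by lia.
apply: APN_of_bound => [a b a0|inj_d].
  apply: (diff_count_le2 cardF) => //; first by lia.
  have hE : #|F| = 2 * (27 * R ^ 2)./2 + 1 by rewrite cardF qE; lia.
  move=> x; apply: (expf_half_mod hE x (k := 0)).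
  by rewrite -def_m mE cardF qE muln0 addn0; apply: norm_exponent_mod3.
apply: (not_planar_mod3 (r := r) _ _ d2 inj_d); first by rewrite cardF -nE.
by rewrite /r n3 /=; lia.
Qed.
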